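(* The least cardinality of a finite metric space $X$ of diameter at most one for which $S'(X)$ is not a Choquet simplex is $4$. Moreover, for every integer $m\ge4$ there is a metric space $X$ of diameter at most one with exactly $m$ points for which $S'(X)$ is not a Choquet simplex.
   Context: The construction $S'$: Let $(X,d)$ be a nonempty separable metric space with $\operatorname{diam}(X)\le 1$. For a sequence $D=(d_n)_{n\ge 1}$ (repetitions allowed) whose terms form a dense subset of $X$, put $\iota_D:X\to[0,1]^{\mathbb{N}}$, $\iota_D(x)=(d(x,d_1),d(x,d_2),\ldots)$, and let $S'_D(X)$ be the closed convex hull of $\iota_D(X)$ in $[0,1]^{\mathbb{N}}$ (product topology). Up to affine homeomorphism $S'_D(X)$ does not depend on the choice of $D$ (a known result of Sabok), and $S'(X)$ denotes $S'_D(X)$ for any such $D$. All metric spaces are nonempty. A compact metrizable convex set $K$ (in a Hausdorff locally convex space) is a (Choquet) simplex if each point of $K$ is the barycenter of a unique Borel probability measure carried by the set $\operatorname{ext}(K)$ of extreme points of $K$. *)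

(* Defs.v *)
From HB Require Import structures.
From mathcomp Require Import all_boot all_order all_algebra.
From mathcomp Require Import all_classical all_reals all_analysis.

Set Implicit Arguments.
Unset Strict Implicit.
Unset Printing Implicit Defensive.

Import Order.TTheory GRing.Theory Num.Theory.
Import numFieldNormedType.Exports.

Local Open Scope classical_set_scope.
Local Open Scope ring_scope.

(* The library's sigma-algebras live on pointed types; a vector space is
   pointed by 0 through this alias. *)
Definition pointed_tvs (R : realType) (E : tvsType R) : Type := E.

HB.instance Definition _ (R : realType) (E : tvsType R) :=
  Choice.copy (pointed_tvs E) E.
HB.instance Definition _ (R : realType) (E : tvsType R) :=
  isPointed.Build (pointed_tvs E) (0 : E).

Definition borel (R : realType) (E : tvsType R) :=
  g_sigma_algebraType (@open E : set (set (pointed_tvs E))).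

Section choquet.
Variables (R : realType) (E : tvsType R).
Implicit Types (K : set E) (x y z : E).

Definition extreme_points K : set E :=
  [set x | K x /\ forall y z (t : R), K y -> K z -> 0 < t < 1 ->
     x = t *: y + (1 - t) *: z -> y = x /\ z = x].

(* The subspace topology of K is induced by a metric on K. *)
Definition metrizable_set K := exists d : E -> E -> R,
  [/\ forall x y, K x -> K y -> 0 <= d x y,
      forall x y, K x -> K y -> (d x y = 0 <-> x = y),
      forall x y, K x -> K y -> d x y = d y x,
      forall x y z, K x -> K y -> K z -> d x z <= d x y + d y z &
      forall x (U : set E), K x ->
        (within K (nbhs x) U <->
         exists2 e : R, 0 < e & forall y, K y -> d x y < e -> U y)].

(* Borel probability measures on K carried by ext K are represented as Borel
   probability measures on E for which the complement of ext K is null. *)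
Definition carried_by (mu : probability (borel E) R) (A : set E) :=
  mu.-negligible (~` A : set (borel E)).

Definition barycenter K (mu : probability (borel E) R) x :=
  forall f : {linear E -> R^o}, continuous f ->
    ((f x)%:E = \int[mu]_(y in (K : set (borel E))) (f y)%:E)%E.

Record compact_metrizable_convex K : Prop := {
  cmc_hausdorff : hausdorff_space E ;
  cmc_compact : compact K ;
  cmc_metrizable : metrizable_set K ;
  cmc_convex : convex_set (K : set (convex_lmodType E)) }.

(* The library's measures are functions on all sets, with irrelevant values
   outside of the sigma-algebra: uniqueness is equality on Borel sets. *)
Record choquet_simplex K : Prop := {
  simplex_cmc : compact_metrizable_convex K ;
  simplex_unique : forall x, K x ->
    exists mu : probability (borel E) R,
      [/\ carried_by mu (extreme_points K), barycenter K mu x &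
          forall nu : probability (borel E) R,
            carried_by nu (extreme_points K) -> barycenter K nu x ->
            forall A : set (borel E), measurable A -> nu A = mu A] }.

Definition closed_convex_hull (A : set E) : set E :=
  smallest [set C : set E |
    closed C /\ convex_set (C : set (convex_lmodType E))] A.

End choquet.

(* R^N with the product topology, as a locally convex space. *)
Section RN.
Variable R : realType.

Definition RN : Type := {ptws nat -> R^o}.

HB.instance Definition _ := Uniform.copy RN {ptws nat -> R^o}.
HB.instance Definition _ := GRing.Lmodule.copy RN (nat -> R^o).

Lemma coord_continuous n : continuous (fun x : RN => (x n : R^o)).
Proof. exact: (@proj_continuous nat (fun=> R^o) n). Qed.

Lemma RN_continuous (T : topologicalType) (f : T -> RN) :
  (forall n, continuous (fun t => (f t n : R^o))) -> continuous f.
Proof.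
move=> fc t; apply/cvg_sup => n U.
have /= -> := @nbhsE (initial_topology (fun f : nat -> R^o => f n)) (f t).
case=> B [[C oC <- Cx]] /filterS; apply.
apply: (fc n t); exact: open_nbhs_nbhs.
Qed.

Lemma coord_comp (T : topologicalType) (f : T -> RN) n :
  continuous f -> continuous (fun t => (f t n : R^o)).
Proof.
by move=> fc t; apply: (@continuous_comp _ _ _ f (fun y : RN => (y n : R^o)));
  [exact: fc|exact: coord_continuous].
Qed.

Let fst_continuous (S T : topologicalType) :
  continuous (fun z : S * T => z.1).
Proof. by move=> z; exact: cvg_fst. Qed.

Let snd_continuous (S T : topologicalType) :
  continuous (fun z : S * T => z.2).
Proof. by move=> z; exact: cvg_snd. Qed.

Let RN_add_continuous : continuous (fun z : RN * RN => z.1 + z.2).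
Proof.
pose T : topologicalType := (RN * RN)%type.
refine (@RN_continuous T (fun z => z.1 + z.2) _) => n z.
have c1 := @coord_comp T (fun z => z.1) n (@fst_continuous RN RN) z.
have c2 := @coord_comp T (fun z => z.2) n (@snd_continuous RN RN) z.
exact (continuousD c1 c2).
Qed.

Let RN_scale_continuous : continuous (fun z : R^o * RN => z.1 *: z.2).
Proof.
pose T : topologicalType := (R^o * RN)%type.
refine (@RN_continuous T (fun z => z.1 *: z.2) _) => n z.
have c2 := @coord_comp T (fun z => z.2) n (@snd_continuous R^o RN) z.
exact (continuousM (@fst_continuous R^o RN z) c2).
Qed.

Lemma coord_convex n (C : set R^o) : convex_set C ->
  convex_set ([set x : RN | C (x n)] : set (convex_lmodType RN)).
Proof.
move=> cC x y l /[!inE] Cx Cy.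
have := cC (x n) (y n) l; rewrite !inE; exact.
Qed.

Let RN_locally_convex :
  exists2 B : set_system RN, (forall b, b \in B -> convex_set b) & basis B.
Proof.
pose B : set_system RN :=
  [set U | open U /\ convex_set (U : set (convex_lmodType RN))].
exists B; first by move=> b; rewrite inE => -[].
split; first by move=> b [].
move=> x.
have FF : Filter (filter_from [set U | B U /\ U x] id).
  apply: filter_from_filter.
    exists setT; split=> //; split; first exact: openT.
    by move=> ? ? ? _ _; rewrite inE.
  move=> U V [[oU cU] Ux] [[oV cV] Vx]; exists (U `&` V) => //.
  split=> //; split; first exact: openI.
  move=> a b l; rewrite !inE => -[Ua Va] [Ub Vb]; split.
    by have := cU a b l; rewrite !inE; exact.
  by have := cV a b l; rewrite !inE; exact.
apply/cvg_sup => n U.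
have /= -> := @nbhsE (initial_topology (fun f : nat -> R^o => f n)) x.
case=> V [[C oC <- Cx]] VU.
have [b0 bc [bo bn]] := @locally_convex R R^o.
have /bn [W [W0 Wx] WC] : nbhs (x n : R^o) C by exact: open_nbhs_nbhs.
exists [set y : RN | W (y n)]; last by move=> y Wy; apply: VU; exact: WC.
split=> //; split.
  move: (@coord_continuous n) => /continuousP; apply; exact: bo.
by apply: coord_convex; apply: bc; rewrite inE.
Qed.

HB.instance Definition _ :=
  PreTopologicalNmodule_isTopologicalNmodule.Build RN RN_add_continuous.
HB.instance Definition _ :=
  TopologicalNmodule_isTopologicalLmodule.Build R RN RN_scale_continuous.
HB.instance Definition _ := Uniform_isTvs.Build R RN RN_locally_convex.

Lemma RN_hausdorff : hausdorff_space RN.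
Proof. by apply: hausdorff_product => n; exact: norm_hausdorff. Qed.

Definition cube : set RN := [set x | forall n, 0 <= x n <= 1].

Lemma cube_compact : compact cube.
Proof.
have := @tychonoff nat (fun=> R^o) (fun=> `[(0:R), 1]%classic)
  (fun=> @segment_compact R 0 1).
rewrite (_ : [set f : _ | _] = cube)//.
Qed.

Lemma cube_convex : convex_set (cube : set (convex_lmodType RN)).
Proof.
move=> x y l /[!inE] xc yc n.
have /andP[x0 x1] := xc n; have /andP[y0 y1] := yc n.
rewrite (_ : _ n = l%:num * x n + (1 - l%:num) * y n)//.
have l0 : 0 <= l%:num :> R by [].
have l1 : l%:num <= 1 :> R by [].
apply/andP; split.
  by rewrite addr_ge0// mulr_ge0// subr_ge0.
rewrite -[leRHS](subrKC l%:num) lerD//; first by rewrite ler_piMr.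
by rewrite ler_piMr// subr_ge0.
Qed.

Let cube_dist (x y : RN) : R :=
  sup (range (fun n => `|x n - y n| / n.+1%:R)).

Let cube_dist_le1 (x y : RN) n : cube x -> cube y ->
  `|x n - y n| / n.+1%:R <= n.+1%:R^-1.
Proof.
move=> /(_ n)/andP[x0 x1] /(_ n)/andP[y0 y1].
rewrite ler_piMl// ler_norml; apply/andP; split.
  by rewrite lerNl opprB lerBlDr (le_trans y1)// lerDl.
by rewrite lerBlDr (le_trans x1)// lerDl.
Qed.

Let cube_dist_sup (x y : RN) : cube x -> cube y ->
  has_sup (range (fun n => `|x n - y n| / n.+1%:R)).
Proof.
move=> cx cy; split; first by exists (`|x 0 - y 0| / 1%:R), 0.
exists 1 => _ [n _ <-]; rewrite (le_trans (cube_dist_le1 n cx cy))//.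
by rewrite invf_le1// ler1n.
Qed.

Let cube_distP (x y : RN) (e : R) : cube x -> cube y ->
  cube_dist x y <= e <-> forall n, `|x n - y n| / n.+1%:R <= e.
Proof.
move=> cx cy; split=> [de n|de].
  apply: le_trans de; apply: ub_le_sup; last by exists n.
  by have [] := cube_dist_sup cx cy.
apply: ge_sup; first by have [] := cube_dist_sup cx cy.
by move=> _ [n _ <-].
Qed.

Let cube_dist_ub (x y : RN) n : cube x -> cube y ->
  `|x n - y n| / n.+1%:R <= cube_dist x y.
Proof. by move=> cx cy; have /cube_distP := lexx (cube_dist x y); apply. Qed.

Let cube_near (x : RN) (e : R) (N : nat) : 0 < e ->
  \forall y \near x, forall n, (n < N)%N -> `|x n - y n| < e.
Proof.
move=> e0; elim: N => [|N IH]; first by apply: filterE => y.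
have cN : \forall y \near x, `|x N - y N| < e.
  by have /cvgrPdist_lt := @coord_continuous N x; apply.
apply: filterS2 IH cN => y yN yN1 n.
by rewrite ltnS leq_eqVlt => /predU1P[->//|]; exact: yN.
Qed.

Lemma metrizable_sub_cube (K : set RN) : K `<=` cube -> metrizable_set K.
Proof.
move=> Kc; exists cube_dist; split.
- move=> x y /Kc cx /Kc cy; apply: le_trans (cube_dist_ub 0 cx cy).
  by rewrite divr_ge0.
- move=> x y /Kc cx /Kc cy; split=> [d0|<-]; last first.
    apply/eqP; rewrite eq_le; apply/andP; split.
      by apply/cube_distP => // n; rewrite subrr normr0 mul0r.
    by apply: le_trans (cube_dist_ub 0 cx cx); rewrite divr_ge0.
  apply/funext => n; apply/eqP; rewrite -subr_eq0 -normr_le0.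
  have := cube_dist_ub n cx cy.
  by rewrite d0 pmulr_lle0// invr_gt0.
- move=> x y Kx Ky; rewrite /cube_dist; congr (sup _).
  by rewrite eqEsubset; split=> _ [n _ <-]; exists n => //; rewrite distrC.
- move=> x y z /Kc cx /Kc cy /Kc cz; apply/cube_distP => // n.
  apply: le_trans (lerD (cube_dist_ub n cx cy) (cube_dist_ub n cy cz)).
  by rewrite -mulrDl ler_pM2r ?invr_gt0// ler_distD.
- move=> x U Kx; have cx := Kc _ Kx; split=> [|[e e0 eU]].
    pose B (e : R) : set RN := [set y | K y /\ cube_dist x y < e].
    have FF : Filter (filter_from [set e : R | 0 < e] B).
      apply: filter_from_filter; first by exists 1 => /=.
      move=> a b /= a0 b0; exists (Num.min a b); first by rewrite /= lt_min a0.
      by move=> y [Ky]; rewrite lt_min => /andP[? ?]; split.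
    have : filter_from [set e : R | 0 < e] B --> x.
      apply/cvg_sup => n V.
      have /= -> := @nbhsE (initial_topology (fun f : nat -> R^o => f n)) x.
      case=> W [[C oC <- Cx]] WV.
      have /nbhs_ballP[r /= r0 rC] : nbhs (x n : R^o) C by exact: open_nbhs_nbhs.
      exists (r / n.+1%:R) => /=; first by rewrite divr_gt0.
      move=> y [Ky dy]; apply: WV => /=; apply: rC.
      rewrite -ball_normE/=.
      have := le_lt_trans (cube_dist_ub n cx (Kc _ Ky)) dy.
      by rewrite ltr_pM2r// invr_gt0.
    move=> /(_ _) Fx /Fx[e /= e0 eU]; exists e => // y Ky dy.
    exact: (eU y).
  have e20 : 0 < e / 2 by rewrite divr_gt0.
  have [N _ /(_ N (leqnn N)) Ne] := near_infty_natSinv_lt (PosNum e20).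
  rewrite /within/=; near=> y => Ky; apply: eU => //.
  apply: (@le_lt_trans _ _ (e / 2)); last by rewrite gtr_pMr// invf_lt1// ltr1n.
  apply/cube_distP; [by []|exact: Kc|move=> n].
  have [nN|Nn] := ltnP n N.
    rewrite ler_pdivrMr// (@le_trans _ _ (e / 2))//.
      by apply: ltW; move: n nN; near: y; exact: cube_near.
    by rewrite ler_peMr ?ler1n// ltW.
  apply: le_trans (cube_dist_le1 n cx (Kc _ Ky)) _.
  apply: le_trans (ltW Ne); rewrite lef_pV2 ?posrE// ler_nat.
Unshelve. all: by end_near. Qed.

End RN.

Definition diam_le1 (R : realType) (X : metricType R) :=
  forall x y : X, mdist x y <= 1.

Section Sprime.
Variables (R : realType) (X : metricType R) (D : nat -> X).

(* The map iota_D. *)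
Definition dist_seq (x : X) : RN R := fun n => mdist x (D n).

(* The hull is taken in R^N: as [0,1]^N is closed and convex, this is also the
   hull in [0,1]^N when X has diameter at most 1. *)
Definition Sprime : set (RN R) := closed_convex_hull (range dist_seq).

Lemma Sprime_closed : closed Sprime.
Proof. by apply: closed_bigI => C [[]]. Qed.

Lemma Sprime_convex : convex_set (Sprime : set (convex_lmodType (RN R))).
Proof.
move=> x y l /[!inE] Sx Sy C CD.
by have := CD.1.2 x y l; rewrite !inE; apply; [exact: Sx|exact: Sy].
Qed.

Lemma Sprime_sub_cube : diam_le1 X -> Sprime `<=` @cube R.
Proof.
move=> diam1; apply: smallest_sub.
  split; last exact: cube_convex.
  apply: compact_closed; [exact: RN_hausdorff|exact: cube_compact].
by move=> _ [x _ <-] n; rewrite mdist_ge0 diam1.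
Qed.

(* Hence ~ choquet_simplex Sprime can only come from the failure of existence
   or uniqueness of representing measures. *)
Lemma Sprime_cmc : diam_le1 X -> compact_metrizable_convex Sprime.
Proof.
move=> /Sprime_sub_cube Sc; split.
- exact: RN_hausdorff.
- exact: subclosed_compact Sprime_closed (@cube_compact R) Sc.
- exact: metrizable_sub_cube.
- exact: Sprime_convex.
Qed.

End Sprime.

(* Main.v *)
Require Import Defs.
From HB Require Import structures.
From mathcomp Require Import all_boot all_order all_algebra.
From mathcomp Require Import all_classical all_reals all_analysis.
From mathcomp Require Import measurable_realfun lra zify.

Set Implicit Arguments.
Unset Strict Implicit.
Unset Printing Implicit Defensive.

Import Order.TTheory GRing.Theory Num.Theory.
Import numFieldNormedType.Exports.

Local Open Scope classical_set_scope.
Local Open Scope ring_scope.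

(* Proof idea. For finite X the set S'(X) is the convex hull of the points
   v_x = iota_D(x). Each v_x is extreme: the coordinate of S'(X) at an index of
   x is nonnegative and vanishes at v_x only. Hence S'(X) is a simplex if and
   only if the v_x are affinely independent.
   An affine relation sum_x w_x v_x = 0 with at most three points has, up to
   sign, at most one positive weight w_x, and the coordinate at x, where that
   weight is multiplied by d(x, x) = 0, then forces all the weights to vanish.
   With four or more points, take a 4-cycle with edges of length 1/2 and put
   any other point at distance 1/2 from everything: the two pairs of opposite
   vertices of the cycle have the same midpoint. *)

(** * Integrals against measures carried by finitely many points *)

(** On [K], [f] agrees almost everywhere with its restriction to the support, and the integral of
    that restriction splits over disjoint singletons. *)
Lemma integral_finite_support d (T : measurableType d) (R : realType)
    (mu : {measure set T -> \bar R}) (n : nat) (v : nat -> T) (K : set T)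
    (f : T -> R) :
  measurable K -> (forall x : T, measurable [set x]) ->
  {in `I_n &, injective v} -> v @` `I_n `<=` K ->
  mu.-negligible (~` (v @` `I_n)) -> measurable_fun K f ->
  (\int[mu]_(x in K) (f x)%:E = \sum_(i < n) (f (v i))%:E * mu [set v i])%E.
Proof.
move=> mK m1 vI vK negl /measurable_EFinP mf.
have VE : v @` `I_n = \big[setU/set0]_(i < n) [set v i].
  rewrite -(bigcup_mkord n (fun i => [set v i])); apply/seteqP; split.
    by move=> _ [i ni <-]; exists i.
  by move=> x [i ni ->]; exists i.
have mV : measurable (v @` `I_n) by rewrite VE; exact: bigsetU_measurable.
rewrite (ae_eq_integral ((EFin \o f) \_ (v @` `I_n)))//; first last.
- have [N [mN N0 VN]] := negl; exists N; split=> // x /= xV; apply: VN => Vx.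
  by apply: xV => Kx; rewrite patchE mem_set.
- apply/measurable_restrict => //; apply: measurable_funS mf => //.
rewrite -integral_mkcondr (setIidr vK) VE.
rewrite -(big_mkord xpredT (fun i => [set v i])).
rewrite integral_bigsetU_EFin//; first last.
- rewrite big_mkord -VE; exact: measurable_funS mf.
- move=> i j /= /[!mem_index_iota] ni nj [x [/= -> vij]].
  by apply: vI => //; rewrite inE.
- exact: iota_uniq.
rewrite big_mkord; apply: eq_bigr => i _.
rewrite (eq_integral (cst (f (v i))%:E)) ?integral_cst//.
by move=> x; rewrite inE/= => ->.
Qed.

(** * Borel measurability in a topological vector space *)

Section borel_measurability.
Variables (R : realType) (E : tvsType R).

Lemma open_borel (A : set E) : open A -> measurable (A : set (borel E)).
Proof. by move=> oA; exact: sub_sigma_algebra. Qed.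

Lemma closed_borel (A : set E) : closed A -> measurable (A : set (borel E)).
Proof.
move=> cA; rewrite -(setCK A); apply: measurableC; apply: open_borel.
exact: closed_openC.
Qed.

Lemma continuous_borel (f : E -> R) : continuous (f : E -> R^o) ->
  measurable_fun setT (f : borel E -> R).
Proof.
move=> fc; apply: (measurability _ (RGenOpens.measurableE R)).
move=> _ [_ [a [b ->] <-]]; rewrite setTI.
apply: open_borel; move/continuousP : fc; apply; exact: interval_open.
Qed.
End borel_measurability.

Lemma tvs_scalel_continuous (R : realType) (E : tvsType R) (x : E) :
  continuous (fun k : R^o => k *: x).
Proof.
move=> k.
exact: (cvg_comp2 cvg_id (cvg_cst x) (@scale_continuous R E (k, x))).
Qed.

(** * Convex hulls of finitely many points *)

Section finite_hull.
Variables (R : realType) (E : tvsType R) (n : nat) (v : nat -> E).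
Implicit Types t : nat -> R.

(* Weights are elements of R^N, only the first n of which matter, so that
   compactness comes from that of the cube. *)
Definition weights : set (RN R) :=
  [set t | cube t /\ \sum_(i < n) t i = 1].

Definition finite_hull : set E :=
  [set \sum_(i < n) t i *: v i | t in weights].

(** The cube constrains every coordinate, hence the cut-off beyond [n]; below [n], a weight is at
    most 1 because the others are nonnegative. *)
Lemma weights_of_ge0 t : (forall i, (i < n)%N -> 0 <= t i) ->
  \sum_(i < n) t i = 1 ->
  weights (fun i => if (i < n)%N then t i else 0).
Proof.
move=> t0 t1; split=> [i|]; last first.
  by rewrite -[RHS]t1; apply: eq_bigr => i _; rewrite ltn_ord.
case: ifPn => [ni|_]; last by rewrite lexx ler01.
rewrite t0//= -t1 (bigD1 (Ordinal ni))//= lerDl sumr_ge0// => j _.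
exact: t0.
Qed.

Lemma finite_hull_ge0 t : (forall i, (i < n)%N -> 0 <= t i) ->
  \sum_(i < n) t i = 1 -> finite_hull (\sum_(i < n) t i *: v i).
Proof.
move=> t0 t1; exists (fun i => if (i < n)%N then t i else 0).
  exact: weights_of_ge0.
by apply: eq_bigr => i _; rewrite ltn_ord.
Qed.

Lemma finite_hull_vertex i : (i < n)%N -> finite_hull (v i).
Proof.
move=> ni.
have -> : v i = \sum_(j < n) (j == i :> nat)%:R *: v j.
  rewrite (bigD1 (Ordinal ni))//= eqxx scale1r big1 ?addr0// => j.
  by rewrite -val_eqE/= => /negPf ->; rewrite scale0r.
apply: (@finite_hull_ge0 (fun j => (j == i)%:R)) => //.
rewrite (bigD1 (Ordinal ni))//= eqxx big1 ?addr0// => j.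
by rewrite -val_eqE/= => /negPf ->.
Qed.

Lemma finite_hull_convex : convex_set (finite_hull : set (convex_lmodType E)).
Proof.
move=> _ _ l /[!inE] -[s [s0 s1] <-] [t [t0 t1] <-].
have -> : conv l (\sum_(i < n) s i *: v i : convex_lmodType E)
                 (\sum_(i < n) t i *: v i : convex_lmodType E) =
    \sum_(i < n) (l%:num * s i + (1 - l%:num) * t i) *: v i.
  rewrite -[LHS]/(l%:num *: (\sum_(i < n) s i *: v i) +
    (1 - l%:num) *: (\sum_(i < n) t i *: v i)).
  under [RHS]eq_bigr do rewrite scalerDl -!scalerA.
  by rewrite big_split/= -!scaler_sumr.
have l0 : 0 <= l%:num :> R by [].
have l1 : l%:num <= 1 :> R by [].
apply: (@finite_hull_ge0 (fun i => l%:num * s i + (1 - l%:num) * t i)) =>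
  [i _|].
  have /andP[? _] := s0 i; have /andP[? _] := t0 i.
  by rewrite addr_ge0// mulr_ge0// subr_ge0.
by rewrite big_split/= -!mulr_sumr s1 t1 !mulr1 addrC subrK.
Qed.

Lemma weights_compact : compact weights.
Proof.
rewrite (_ : weights = @cube R `&`
  ((fun t : RN R => \sum_(i < n) t i : R^o) @^-1` [set 1]))//.
apply: compact_closedI; first exact: cube_compact.
have fc : continuous (fun t : RN R => \sum_(i < n) t i : R^o).
  apply: (@continuous_big R^o _ +%R 0 xpredT) => [|i _].
    exact: add_continuous.
  exact: (@Defs.coord_continuous R i).
have := @closed_comp _ _ (fun t : RN R => \sum_(i < n) t i : R^o) [set 1].
by apply=> [t _|]; [exact: fc|exact: closed_eq].
Qed.

Lemma finite_hull_compact : compact finite_hull.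
Proof.
apply: continuous_compact; last exact: weights_compact.
apply: continuous_subspaceT.
apply: (@continuous_big E _ +%R 0 xpredT) => [|i _ t].
  exact: add_continuous.
apply: (@continuous_comp (RN R) R^o E (fun t : RN R => (t i : R^o))
  (fun k : R^o => k *: v i)); first exact: (@Defs.coord_continuous R i).
exact: tvs_scalel_continuous.
Qed.

(** The finite hull is the continuous image of the compact set of weights, so it is compact, hence
    closed: no limit points have to be added. *)
Lemma finite_hull_sub : hausdorff_space E ->
  closed_convex_hull (v @` `I_n) `<=` finite_hull.
Proof.
move=> hE; apply: smallest_sub; last first.
  by move=> _ [i ni <-]; exact: finite_hull_vertex.
split; last exact: finite_hull_convex.
exact: compact_closed finite_hull_compact.
Qed.

End finite_hull.

(** * Convex combinations and extreme points *)

Section convex_combinations.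
Variables (R : realType) (E : tvsType R) (K : set E).
Hypothesis Kconv : convex_set (K : set (convex_lmodType E)).

Lemma convex_comb (x y : E) (t : R) : K x -> K y -> 0 <= t <= 1 ->
  K (t *: x + (1 - t) *: y).
Proof.
move=> Kx Ky /andP[t0 t1].
have := @Kconv x y (Itv01 t0 t1); rewrite !inE; exact.
Qed.

Lemma convex_sum (n : nat) (v : nat -> E) (t : nat -> R) :
  (forall i, (i < n)%N -> K (v i)) -> (forall i, (i < n)%N -> 0 <= t i) ->
  \sum_(i < n) t i = 1 -> K (\sum_(i < n) t i *: v i).
Proof.
elim: n t => [|n IH] t Kv t0.
  by rewrite big_ord0 => /esym/eqP /[!oner_eq0].
rewrite !big_ord_recr /=; set s := \sum_(i < n) _ => s1.
have s0 : 0 <= s by apply: sumr_ge0 => i _; rewrite t0// ltnW// ltnS.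
have tn : t n = 1 - s by rewrite -s1 addrC addrK.
(* A zero total weight [s] cannot be normalised; then the first [n] weights vanish and only [v n]
   remains. *)
have [s00|sN0] := eqVneq s 0.
  have z i : (i < n)%N -> t i = 0.
    move=> ni; move/eqP: s00; rewrite psumr_eq0; last first.
      by move=> j _; rewrite t0// ltnW// ltnS.
    by move=> /allP /(_ (Ordinal ni)); rewrite mem_index_enum => /(_ isT)/eqP.
  rewrite big1 => [|i _]; last by rewrite z// scale0r.
  by rewrite add0r tn s00 subr0 scale1r; exact: Kv.
have -> : \sum_(i < n) t i *: v i = s *: \sum_(i < n) (t i / s) *: v i.
  rewrite scaler_sumr; apply: eq_bigr => i _.
  by rewrite scalerA mulrCA divff// mulr1.
rewrite tn; apply: convex_comb; last 2 first.
- exact: Kv.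
- by rewrite s0 -subr_ge0 -tn t0.
apply: (IH (fun i => t i / s)) => [i ni|i ni|].
- by apply: Kv; rewrite ltnW.
- by rewrite divr_ge0// t0// ltnW.
- by rewrite -mulr_suml divff.
Qed.

(** Split off the last point, [s] being the total weight of the others: [x] is a combination of the
    others, or [v n], or lies properly between [v n] and the normalised combination of the others,
    and extremality then gives [v n = x]. *)
Lemma extreme_sum (n : nat) (v : nat -> E) (t : nat -> R) x :
  (forall i, (i < n)%N -> K (v i)) -> (forall i, (i < n)%N -> 0 <= t i) ->
  \sum_(i < n) t i = 1 -> extreme_points K x -> x = \sum_(i < n) t i *: v i ->
  (v @` `I_n) x.
Proof.
elim: n => [|n IH] Kv t0; first by rewrite big_ord0 => /esym/eqP /[!oner_eq0].
have t0' i : (i < n)%N -> 0 <= t i by move=> ni; apply: t0; rewrite ltnW.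
have Kv' i : (i < n)%N -> K (v i) by move=> ni; apply: Kv; rewrite ltnW.
rewrite !big_ord_recr /=; set s := \sum_(i < n) _ => s1 ext xE.
have s0 : 0 <= s by apply: sumr_ge0 => i _; rewrite t0'.
have tn : t n = 1 - s by rewrite -s1 addrC addrK.
have [sE1|sN1] := eqVneq s 1.
  have xE' : x = \sum_(i < n) t i *: v i.
    by rewrite xE tn sE1 subrr scale0r addr0.
  have [i ni <-] := IH Kv' t0' sE1 ext xE'.
  by exists i => //=; rewrite ltnW.
exists n => //=; have [Kx ext_x] := ext.
have [sE0|sN0] := eqVneq s 0.
  have z i : (i < n)%N -> t i = 0.
    move=> ni; move/eqP: sE0; rewrite psumr_eq0; last first.
      by move=> j _; rewrite t0'.
    by move=> /allP /(_ (Ordinal ni)); rewrite mem_index_enum => /(_ isT)/eqP.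
  rewrite xE big1 => [|i _]; last by rewrite z// scale0r.
  by rewrite add0r tn sE0 subr0 scale1r.
have Ky : K (\sum_(i < n) (t i / s) *: v i).
  apply: (@convex_sum n v (fun i => t i / s)) => // [i ni|]; last first.
    by rewrite -mulr_suml divff.
  by rewrite divr_ge0// t0'.
have [] // := ext_x _ _ s Ky (Kv n (ltnSn n)).
  rewrite !lt_neqAle eq_sym sN0 s0 sN1 -subr_ge0 -tn t0//.
rewrite xE -tn scaler_sumr; congr (_ + _); apply: eq_bigr => i _.
by rewrite scalerA mulrCA divff// mulr1.
Qed.

End convex_combinations.

(** * Probability measures with finitely many atoms *)

Section atomic_probability.
Context d (T : measurableType d) (R : realType).
Variables (n : nat) (v : nat -> T) (t : nat -> R).
Hypothesis tw : weights n t.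

Let t_ge0 i : 0 <= t i.
Proof. by case: tw => /(_ i)/andP[]. Qed.

Definition atomic := msum (fun i => mscale (NngNum (t_ge0 i)) \d_(v i)) n.

HB.instance Definition _ := Measure.on atomic.

Lemma atomicE A : (atomic A = \sum_(i < n) (t i * \1_A (v i))%:E)%E.
Proof. by apply: eq_bigr => i _; rewrite EFinM. Qed.

Let atomicT : atomic setT = 1%E.
Proof.
rewrite atomicE sumEFin; under eq_bigr do rewrite indicT mulr1.
by case: tw => _ ->.
Qed.

HB.instance Definition _ := Measure_isProbability.Build _ _ _ atomic atomicT.

Lemma atomic_vertex i : {in `I_n &, injective v} -> (i < n)%N ->
  atomic [set v i] = (t i)%:E.
Proof.
move=> vI ni; rewrite atomicE sumEFin (bigD1 (Ordinal ni))//=.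
rewrite indicE mem_set// mulr1 big1 ?addr0// => j ji.
rewrite indicE memNset ?mulr0//= => vji; move/eqP: ji; apply; apply: val_inj.
by apply: vI => //; rewrite inE//=.
Qed.

Lemma atomic_negligible : (forall x : T, measurable [set x]) ->
  atomic.-negligible (~` (v @` `I_n)).
Proof.
move=> m1; apply/negligibleP.
  apply: measurableC; rewrite -bigcup_imset1; exact: bigcup_measurable.
rewrite -[LHS]/(atomic _) atomicE big1// => i _.
rewrite indicE memNset ?mulr0//=.
by apply: contrapT => /contrapT; apply; exists i => /=.
Qed.

End atomic_probability.

(** * Representing measures: simplices and affine independence of the vertices *)

Section representing_measures.
Variables (R : realType) (E : tvsType R) (n : nat) (v : nat -> E) (K : set E).
Hypothesis hE : hausdorff_space E.
Hypothesis vI : {in `I_n &, injective v}.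
Hypothesis Kclosed : closed K.
Hypothesis vext : forall i, (i < n)%N -> extreme_points K (v i).

Let borel1 (x : borel E) : measurable [set x].
Proof.
apply: (@closed_borel R E [set x]).
exact: accessible_closed_set1 (hausdorff_accessible hE) x.
Qed.

Let vK : v @` `I_n `<=` K.
Proof. by move=> _ [i ni <-]; case: (vext ni). Qed.

Let atomic_borel_vertex (t : nat -> R) (tw : weights n t) i : (i < n)%N ->
  atomic (v : nat -> borel E) tw [set v i] = (t i)%:E.
Proof. exact: (@atomic_vertex _ (borel E)). Qed.

Lemma atomic_carried (t : nat -> R) (tw : weights n t) :
  carried_by (atomic (v : nat -> borel E) tw) (extreme_points K).
Proof.
apply: negligibleS (atomic_negligible _ tw borel1) => x /= Kx [i ni vi].
by apply: Kx; rewrite -vi; exact: vext.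
Qed.

Lemma integral_vertices (mu : probability (borel E) R) (f : {linear E -> R^o}) :
  mu.-negligible (~` (v @` `I_n) : set (borel E)) -> continuous f ->
  (\int[mu]_(y in (K : set (borel E))) (f y)%:E =
   (f (\sum_(i < n) fine (mu [set v i]) *: v i))%:E)%E.
Proof.
move=> negl fc; rewrite (@integral_finite_support _ (borel E) R mu n v)//.
- rewrite linear_sum -sumEFin; apply: eq_bigr => i _.
  rewrite linearZ_LR EFinM muleC fineK//.
  by rewrite fin_num_measure.
- exact: closed_borel.
- apply: measurable_funS (continuous_borel fc) => //.
Qed.

Lemma atomic_barycenter (t : nat -> R) (tw : weights n t) :
  barycenter K (atomic (v : nat -> borel E) tw) (\sum_(i < n) t i *: v i).
Proof.
move=> f fc; rewrite integral_vertices//; last exact: atomic_negligible.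
congr (f _)%:E; apply: eq_bigr => i _.
have := atomic_borel_vertex tw (ltn_ord i).
by move/(congr1 (fun z => fine z *: v i)).
Qed.

(** Both weight vectors give atomic measures carried by the extreme points and with the same
    barycenter; uniqueness equates their masses at each vertex. *)
Lemma choquet_simplex_weights_inj (s t : nat -> R) :
  choquet_simplex K -> weights n s -> weights n t ->
  \sum_(i < n) s i *: v i = \sum_(i < n) t i *: v i ->
  forall i, (i < n)%N -> s i = t i.
Proof.
move=> [Kcmc Kuniq] sw tw st i ni.
have Kx : K (\sum_(i < n) s i *: v i).
  apply: (@convex_sum _ _ _ (cmc_convex Kcmc) n v s); last exact: sw.2.
    by move=> j /vext[].
  by move=> j _; have /andP[] := sw.1 j.
have [mu [_ _ mu_uniq]] := Kuniq _ Kx.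
have sE :=
  mu_uniq _ (atomic_carried sw) (atomic_barycenter sw) _ (borel1 (v i)).
have tbary : barycenter K (atomic (v : nat -> borel E) tw)
    (\sum_(i < n) s i *: v i) by rewrite st; exact: atomic_barycenter.
have tE := mu_uniq _ (atomic_carried tw) tbary _ (borel1 (v i)).
apply: EFin_inj.
rewrite -(atomic_borel_vertex sw ni) -(atomic_borel_vertex tw ni).
exact: etrans sE (esym tE).
Qed.

(** Affine independence is tested through continuous functionals because these are what [barycenter]
    controls. *)
Lemma choquet_simplex_affine_free : compact_metrizable_convex K ->
  K `<=` finite_hull n v ->
  (forall w : nat -> R, \sum_(i < n) w i = 0 ->
    (forall f : {linear E -> R^o}, continuous f ->
      f (\sum_(i < n) w i *: v i) = 0) ->
    forall i, (i < n)%N -> w i = 0) ->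
  choquet_simplex K.
Proof.
move=> Kcmc Khull free; split=> // x Kx.
have [t tw xE] := Khull _ Kx.
exists (atomic (v : nat -> borel E) tw); split.
- exact: atomic_carried.
- by rewrite -xE; exact: atomic_barycenter.
move=> nu nu_ext nu_bary.
(* An extreme point of [K] is a convex combination of the [v i], hence one of them, so [nu] lives on
   the vertices. *)
have nuV : nu.-negligible (~` (v @` `I_n) : set (borel E)).
  apply: negligibleS nu_ext => y + extKy; apply.
  have [s sw yE] := Khull _ extKy.1.
  apply: (@extreme_sum _ _ _ (cmc_convex Kcmc) n v s y) extKy (esym yE).
  - by move=> i /vext[].
  - by move=> i _; have /andP[] := sw.1 i.
  - exact: sw.2.
(* Integrating the indicator of [A] shows that [nu] is determined by its masses at the vertices. *)
have nuE (A : set (borel E)) : measurable A ->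
    nu A = (\sum_(i < n) (fine (nu [set v i]) * \1_A (v i))%:E)%E.
  move=> mA; rewrite -(setIT A) -integral_indic//.
  rewrite (@integral_finite_support _ (borel E) R nu n v setT)//.
  by apply: eq_bigr => i _; rewrite setIT EFinM muleC fineK// fin_num_measure.
(* The differences of the weights sum to 0, both total masses being 1, and every continuous
   functional kills their combination of the [v i], both barycenters being [x]. *)
have tnu i : (i < n)%N -> t i = fine (nu [set v i]).
  move=> ni; apply/eqP; rewrite -subr_eq0; apply/eqP.
  apply: (free (fun i => t i - fine (nu [set v i]))) ni => [|f fc].
    rewrite sumrB tw.2; apply/eqP; rewrite subr_eq0; apply/eqP.
    apply: EFin_inj; rewrite -(probability_setT nu) nuE// sumEFin.
    by congr _%:E; apply: eq_bigr => j _; rewrite indicT mulr1.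
  under eq_bigr do rewrite scalerBl.
  rewrite sumrB linearB/= xE; apply/eqP; rewrite subr_eq0; apply/eqP.
  by apply: EFin_inj; rewrite nu_bary// integral_vertices.
move=> A mA; rewrite nuE// -[RHS]/(atomic (v : nat -> borel E) tw A).
by rewrite atomicE; apply: eq_bigr => i _; rewrite -tnu.
Qed.

End representing_measures.

(** * Finite metric spaces and their distance matrices *)

Section finite_metric_space.
Variables (R : realType) (X : metricType R).

(** Singletons of a finite metric space are open, so a dense sequence meets each of them. *)
Lemma finite_dense_surj (D : nat -> X) (y : X) : finite_set [set: X] ->
  dense (range D) -> exists k, D k = y.
Proof.
move=> fX dD; have oy : open [set y].
  rewrite -(setCK [set y]); apply: closed_openC.
  have [acc _] := @accessible_finite_set_closed X.
  apply: (acc (hausdorff_accessible (@metric_hausdorff _ X))).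
  exact: sub_finite_set fX.
by have [] := dD [set y] _ oy; [exists y|move=> z [/= -> [k _ <-]]; exists k].
Qed.

Lemma card_eq_enum n : [set: X] !=set0 -> ([set: X] #= `I_n)%card ->
  exists2 x : nat -> X, {in `I_n &, injective x} & x @` `I_n = setT.
Proof.
move=> [x0 _] /card_set_bijP[f [fn fI fS]].
have /choice[x xP] : forall i, exists y, (i < n)%N -> f y = i.
  (* Indices from [n] on get the default value [x0]. *)
  move=> i; have [ni|ni] := boolP (i < n)%N; last by exists x0.
  by have [y _ <-] := fS i ni; exists y.
exists x => [i j|].
  by rewrite !inE => ni nj xij; rewrite -(xP i)// xij xP.
apply/seteqP; split=> // y _; exists (f y); first exact: fn.
by apply: fI; rewrite ?inE// xP//; exact: fn.
Qed.

Lemma dist_rows_free n (x : 'I_n -> X) (w : 'I_n -> R) : (n <= 3)%N ->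
  injective x -> \sum_i w i = 0 ->
  (forall j, \sum_i w i * mdist (x i) (x j) = 0) -> forall i, w i = 0.
Proof.
move=> n3 xI.
(* In row [i] the weight [u i] is multiplied by 0 and the other terms are nonnegative after a change
   of sign, so each vanishes. As distinct points have nonzero distance, [u] vanishes off [i], and
   the zero total gives [u i = 0]. *)
have one_positive (u : 'I_n -> R) i : (forall k, k != i -> u k <= 0) ->
    \sum_k u k = 0 -> \sum_k u k * mdist (x k) (x i) = 0 -> forall k, u k = 0.
  move=> uN u0 row.
  have zk k : k != i -> u k = 0.
    have : \sum_k - (u k * mdist (x k) (x i)) = 0 by rewrite sumrN row oppr0.
    move/eqP; rewrite psumr_eq0 => [|j _]; last first.
      have [->|ji] := eqVneq j i; first by rewrite mdistxx mulr0 oppr0.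
      by rewrite oppr_ge0 mulr_le0_ge0// ?uN// mdist_ge0.
    move=> /allP /(_ k); rewrite mem_index_enum => /(_ isT) /=.
    rewrite oppr_eq0 mulf_eq0 => /orP[/eqP//|/eqP/mdist_positivity/xI ->].
    by rewrite eqxx.
  move=> k; have [->|/zk//] := eqVneq k i.
  by rewrite -u0 (bigD1 i)//= big1 ?addr0.
have few (u : 'I_n -> R) : (#|[pred i | (0 < u i)%R]| <= 1)%N ->
    \sum_k u k = 0 -> (forall j, \sum_k u k * mdist (x k) (x j) = 0) ->
    forall k, u k = 0.
  move=> /card_le1_eqP P1 u0 rows k.
  have [[i ui]|noP] := pselect (exists i, 0 < u i).
    apply: (one_positive u i) => // j; apply: contraNT; rewrite -ltNge => uj.
    by apply/eqP; apply: P1.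
  (* If no weight is positive, any index can serve as the exceptional one. *)
  apply: (one_positive u k) => // j _; rewrite leNgt; apply/negP => uj.
  by apply: noP; exists j.
move=> w0 rows.
have [wP|wP] := leqP #|[pred i | (0 < w i)%R]| 1; first exact: few.
(* Of at most three weights at least two are positive, so at most one is negative and [few] applies
   to [- w]. *)
have wN : (#|[pred i | (0 < - w i)%R]| <= 1)%N.
  have : (#|[pred i | (0 < w i)%R]| + #|[pred i | (0 < - w i)%R]| <= 3)%N.
    rewrite -cardUI (_ : #|[predI _ & _]| = 0)%N ?addn0.
      by apply: leq_trans n3; rewrite -[leqRHS]card_ord; exact: max_card.
    apply: eq_card0 => i; rewrite !inE oppr_gt0.
    by apply/negP => /andP[wi0] /(lt_trans wi0); rewrite ltxx.
  by move=> le3; rewrite -(leq_add2l 2) (leq_trans _ le3)// leq_add2r.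
move=> k; apply/eqP; rewrite -oppr_eq0; apply/eqP.
apply: (few (fun k => - w k)) => //; first by rewrite sumrN w0 oppr0.
move=> j; under eq_bigr do rewrite mulNr.
by rewrite sumrN rows oppr0.
Qed.

End finite_metric_space.

(** * Coordinates and extreme points of S'(X) for finite X *)

Lemma RN_sumE (R : realType) n (t : nat -> R) (v : nat -> RN R) k :
  (\sum_(i < n) t i *: v i : RN R) k = \sum_(i < n) t i * v i k.
Proof. by elim: n => [|n IH]; rewrite ?big_ord0// !big_ord_recr/= -IH. Qed.

Section coordinate.
Variables (R : realType) (k : nat).

(** Named so that evaluation at [k] carries a linear structure and can be used as a functional in
    the test of affine independence. *)
Definition coordinate : RN R -> R^o := fun y => y k.

Lemma coordinate_linear : linear coordinate.
Proof. by []. Qed.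

HB.instance Definition _ :=
  GRing.isLinear.Build R (RN R) R^o _ coordinate coordinate_linear.

End coordinate.

Section Sprime_finite.
Variables (R : realType) (X : metricType R) (D : nat -> X).
Variables (n : nat) (x : nat -> X).
Hypothesis diam1 : diam_le1 X.
Hypothesis xI : {in `I_n &, injective x}.
Hypothesis xS : x @` `I_n = setT.
Hypothesis Dsurj : forall y, exists k, D k = y.

Let v i := dist_seq D (x i).

Lemma Sprime_hull : Sprime D `<=` finite_hull n v.
Proof.
rewrite (_ : v = dist_seq D \o x)// /Sprime -xS image_comp.
apply: finite_hull_sub; exact: RN_hausdorff.
Qed.

Lemma Sprime_vertex i : Sprime D (v i).
Proof. by apply: sub_gen_smallest; exists (x i). Qed.

Lemma vertex_inj : {in `I_n &, injective v}.
Proof.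
move=> i j ni nj vij; apply: xI => //.
have [k Dk] := Dsurj (x i); apply/esym/mdist_positivity.
by move: vij => /(congr1 (@^~ k)); rewrite /v /dist_seq Dk mdistxx.
Qed.

Lemma Sprime_ge0 (u : RN R) k : Sprime D u -> 0 <= u k.
Proof.
by move=> /(Sprime_sub_cube diam1)/(_ k)/andP[].
Qed.

(** Write [u] as a combination of the [v j] with weights [t j]: its coordinate at [k] is the sum of
    the nonnegative terms [t j * mdist (x j) (x i)], which forces [t j = 0] for [j] other than
    [i]. *)
Lemma Sprime_coord0 (u : RN R) k i : (i < n)%N -> D k = x i ->
  Sprime D u -> u k = 0 -> u = v i.
Proof.
move=> ni Dk /Sprime_hull[t [t01 t1] uE] uk0.
have t0 j : 0 <= t j by have /andP[] := t01 j.
have tz j : (j < n)%N -> j != i -> t j = 0.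
  move=> nj ji; have : \sum_(j < n) t j * mdist (x j) (x i) = 0.
    rewrite -[RHS]uk0 -uE RN_sumE; apply: eq_bigr => l _.
    by rewrite /v /dist_seq Dk.
  move/eqP; rewrite psumr_eq0 => [/allP/(_ (Ordinal nj))|l _]; last first.
    by rewrite mulr_ge0// mdist_ge0.
  rewrite mem_index_enum => /(_ isT)/=; rewrite mulf_eq0.
  move=> /orP[/eqP//|/eqP/mdist_positivity xji].
  by case/eqP: ji; apply: xI; rewrite ?inE.
rewrite -uE (bigD1 (Ordinal ni))//= big1 => [|j ji]; last first.
  by rewrite tz ?scale0r//; rewrite -val_eqE in ji.
suff -> : t i = 1 by rewrite scale1r addr0.
rewrite -t1 (bigD1 (Ordinal ni))//= big1 ?addr0// => j ji.
by rewrite tz//; rewrite -val_eqE in ji.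
Qed.

Lemma vertex_extreme i : (i < n)%N -> extreme_points (Sprime D) (v i).
Proof.
move=> ni; split; first exact: Sprime_vertex.
move=> y z s Sy Sz /andP[s0 s1] vE; have [k Dk] := Dsurj (x i).
have y0 := Sprime_ge0 k Sy; have z0 := Sprime_ge0 k Sz.
(* Coordinate [k] vanishes at [v i]; being nonnegative at [y] and [z], which have positive weights,
   it vanishes there too. *)
have : s * y k + (1 - s) * z k = 0.
  rewrite -[LHS]/((s *: y + (1 - s) *: z : RN R) k) -vE.
  by rewrite /v /dist_seq Dk mdistxx.
move=> sum0; split; apply: (Sprime_coord0 ni Dk) => //; nra.
Qed.

End Sprime_finite.

(** * Spaces with at most three points *)

Lemma choquet_simplex_card_le3 (R : realType) (X : metricType R)
    (D : nat -> X) (n : nat) : [set: X] !=set0 -> diam_le1 X ->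
  ([set: X] #= `I_n)%card -> dense (range D) -> (n <= 3)%N ->
  choquet_simplex (Sprime D).
Proof.
move=> X0 diam1 Xn dD n3; have [x xI xS] := card_eq_enum X0 Xn.
have fX : finite_set [set: X] by exists n.
have Dsurj y := finite_dense_surj y fX dD.
apply: (choquet_simplex_affine_free (@RN_hausdorff R)
  (vertex_inj xI Dsurj) (@Sprime_closed _ _ D)
  (fun i => @vertex_extreme _ _ _ _ _ diam1 xI xS Dsurj i)).
- exact: Sprime_cmc.
- exact: Sprime_hull.
move=> w w0 wv i ni.
apply: (dist_rows_free (x := fun i : 'I_n => x i) (w := fun i => w i) n3 _ _ _
  (Ordinal ni)) => //.
- by move=> j k xjk; apply/val_inj/xI => //; rewrite inE/=.
(* The coordinate at an index of [x j] turns the relation between the vertices into row [j] of the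
   distance matrix. *)
- move=> j; have [k Dk] := Dsurj (x j).
  have := wv (coordinate k) (@Defs.coord_continuous R k).
  by rewrite [LHS](RN_sumE n w (dist_seq D \o x)) /= /dist_seq Dk.
Qed.

(** * Spaces with four or more points whose S' is not a simplex *)

(* The 4-cycle 0, 1, 2, 3 with edges of length 1/2, and k further points at
   distance 1/2 from all the others. *)
Definition cycle_space (R : realType) (k : nat) : Type := 'I_k.+4.

Section cycle_space.
Variables (R : realType) (k : nat).
Local Notation X := (cycle_space R k).

HB.instance Definition _ := Finite.copy X 'I_k.+4.

Definition opposite (i j : nat) :=
  (i, j) \in [:: (0, 2); (2, 0); (1, 3); (3, 1)]%N.

Definition cycle_dist (x y : X) : R :=
  if x == y then 0
  else if opposite (x : 'I_k.+4) (y : 'I_k.+4) then 1 else 2^-1.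

Let cycle_dist_bounds x y : x != y -> 2^-1 <= cycle_dist x y <= 1.
Proof. by rewrite /cycle_dist => /negPf ->; case: ifP => _; lra. Qed.

Let cycle_distxx x : cycle_dist x x = 0.
Proof. by rewrite /cycle_dist eqxx. Qed.

Let cycle_dist_eq0 x y : cycle_dist x y = 0 -> x = y.
Proof.
by have [//|/cycle_dist_bounds/andP[d2 _] d0] := eqVneq x y; exfalso; lra.
Qed.

Let cycle_dist_sym x y : cycle_dist x y = cycle_dist y x.
Proof.
have oS (i j : nat) : opposite i j = opposite j i.
  by rewrite /opposite !inE !xpair_eqE; lia.
by rewrite /cycle_dist eq_sym oS.
Qed.

(** Two nonzero distances add up to at least 1, the largest possible distance. *)
Let cycle_dist_triangle y x z :
  cycle_dist x z <= cycle_dist x y + cycle_dist y z.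
Proof.
have [->|xy] := eqVneq x y; first by rewrite cycle_distxx add0r.
have [->|yz] := eqVneq y z; first by rewrite cycle_distxx addr0.
have /andP[? _] := cycle_dist_bounds xy.
have /andP[? _] := cycle_dist_bounds yz.
have [xz|/cycle_dist_bounds/andP[_ ?]] := eqVneq x z; last by lra.
by rewrite {1}xz cycle_distxx; lra.
Qed.

HB.instance Definition _ := isMetric.Build R X
  cycle_distxx cycle_dist_eq0 cycle_dist_sym cycle_dist_triangle.

Lemma cycle_space_diam : diam_le1 X.
Proof.
move=> x y; rewrite -[mdist x y]/(cycle_dist x y).
have [->|/cycle_dist_bounds/andP[]//] := eqVneq x y.
by rewrite cycle_distxx ler01.
Qed.

Lemma cycle_space_card : ([set: X] #= `I_k.+4)%card.
Proof. by rewrite card_eq_sym; exact: card_II. Qed.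

(** Both sums are 1: a vertex of the cycle contributes 0 + 1 to its own pair and 1/2 + 1/2 to the
    other, any further point 1/2 + 1/2 to both. *)
Lemma cycle_space_opposite (y : X) :
  mdist (inord 0 : X) y + mdist (inord 2 : X) y =
  mdist (inord 1 : X) y + mdist (inord 3 : X) y.
Proof.
rewrite -[LHS]/(cycle_dist _ _ + cycle_dist _ _).
rewrite -[RHS]/(cycle_dist _ _ + cycle_dist _ _).
rewrite /cycle_dist /opposite !inE !xpair_eqE -!val_eqE/= !inordK//.
by case: y => -[|[|[|[|y]]]] yk /=; lra.
Qed.

(** For distinct [a] and [b], the weights of the midpoint of vertices [a] and [b]. *)
Let half (a b i : nat) : R := 2^-1 * ((i == a)%:R + (i == b)%:R).

Let half_sum (V : lmodType R) (v : nat -> V) a b : (a < 4)%N -> (b < 4)%N ->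
  \sum_(i < k.+4) half a b i *: v i = 2^-1 *: (v a + v b).
Proof.
have pick c : (c < 4)%N -> \sum_(i < k.+4) (i == c :> nat)%:R *: v i = v c.
  move=> c4; have ck : (c < k.+4)%N by exact: leq_trans c4 _.
  rewrite (bigD1 (Ordinal ck))//= eqxx scale1r big1 ?addr0// => i.
  by rewrite -val_eqE/= => /negPf ->; rewrite scale0r.
move=> a4 b4; rewrite -(pick a a4) -(pick b b4) -big_split scaler_sumr/=.
by apply: eq_bigr => i _; rewrite -scalerDl scalerA.
Qed.

Let half_weights a b : (a < 4)%N -> (b < 4)%N -> (a != b)%N ->
  weights k.+4 (half a b).
Proof.
move=> a4 b4 ab; split.
  move=> i; rewrite /half; have [->|ia] := eqVneq i a.
    by rewrite (negPf ab) addr0 mulr1; lra.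
  by rewrite add0r; case: eqP => _ /=; rewrite ?mulr1 ?mulr0; lra.
(* The total weight is the combination of the constant family 1. *)
have := half_sum (fun=> 1 : R^o) a4 b4; rewrite /GRing.scale/=.
by under eq_bigr do rewrite mulr1; move=> ->; lra.
Qed.

Lemma cycle_space_not_simplex (D : nat -> X) : dense (range D) ->
  ~ choquet_simplex (Sprime D).
Proof.
move=> dD simplex; pose x i : X := inord i.
have xI : {in `I_k.+4 &, injective x}.
  move=> i j; rewrite !inE/= => ik jk /(congr1 (@nat_of_ord k.+4)).
  by rewrite !inordK.
have xS : x @` `I_k.+4 = setT.
  apply/seteqP; split=> // y _; exists (y : 'I_k.+4); first exact: ltn_ord.
  exact: inord_val.
have fX : finite_set [set: X] by exists k.+4; exact: cycle_space_card.
have Dsurj y := finite_dense_surj y fX dD.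
pose v i : RN R := dist_seq D (x i).
have v_opposite : v 0 + v 2 = v 1 + v 3.
  by apply/funext => j; exact: cycle_space_opposite.
have sum_eq : \sum_(i < k.+4) half 0 2 i *: v i =
    \sum_(i < k.+4) half 1 3 i *: v i.
  by rewrite !half_sum// v_opposite.
have := @choquet_simplex_weights_inj R (RN R) k.+4 v
  (Sprime D) (@RN_hausdorff R) (vertex_inj xI Dsurj) (@Sprime_closed _ _ D)
  (fun i => @vertex_extreme _ _ _ _ _ cycle_space_diam xI xS Dsurj i)
  (half 0 2) (half 1 3) simplex
  (@half_weights 0 2 isT isT isT) (@half_weights 1 3 isT isT isT) sum_eq 0 isT.
(* At index 0 the two weights are 1/2 and 0. *)
by rewrite /half/=; lra.
Qed.

End cycle_space.

(* S'(X) is only defined up to affine homeomorphism, through any sequence D of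
   points of X that is dense: "S'(X) is not a simplex" is asserted for all D in
   the two existence claims, and assumed for some D only in the lower bound. *)
Theorem corollary3p5 (R : realType) :
  [/\ exists X : metricType R,
        [/\ diam_le1 X, ([set: X] #= `I_4)%card &
            forall D : nat -> X, dense (range D) ->
              ~ choquet_simplex (Sprime D)],
      forall (X : metricType R) (n : nat),
        [set: X] !=set0 -> diam_le1 X -> ([set: X] #= `I_n)%card ->
        (exists2 D : nat -> X, dense (range D) &
          ~ choquet_simplex (Sprime D)) ->
        (4 <= n)%N &
      forall m : nat, (4 <= m)%N -> exists X : metricType R,
        [/\ diam_le1 X, ([set: X] #= `I_m)%card &
            forall D : nat -> X, dense (range D) ->
              ~ choquet_simplex (Sprime D)]].
Proof.
have cycle k : exists X : metricType R,
    [/\ diam_le1 X, ([set: X] #= `I_k.+4)%card &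
        forall D : nat -> X, dense (range D) -> ~ choquet_simplex (Sprime D)].
  exists (cycle_space R k); split; [exact: cycle_space_diam|
    exact: cycle_space_card|exact: cycle_space_not_simplex].
split; first exact: cycle.
  move=> X n X0 diam1 Xn [D dD]; rewrite ltnNge => nsimplex.
  apply/negP => n3; apply: nsimplex.
  exact: (choquet_simplex_card_le3 X0 diam1 Xn dD n3).
by move=> m m4; rewrite -(subnK m4) addn4; exact: cycle.
Qed.
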